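(* Let $R$ be a principal ideal domain, let $n\geq 2$, and let $a_1,\dots,a_n\in R$ satisfy $Ra_1+\cdots+Ra_n=R$. Let $S=\{(x_1,\dots,x_n)\in R^n : a_1x_1+\cdots+a_nx_n=0\}$, and let $M\subseteq\{1,\dots,n\}$ be a subset with $\sum_{i\in M}Ra_i=R$. Then $\ker\Lambda=Y$; that is, the relations $a_kv(i,j)-a_jv(i,k)+a_iv(j,k)=0$, $(i,j,k)\in E$, are defining relations for $S$ with respect to the generators $v(i,j)$, $(i,j)\in D$: $$S\cong\langle x(i,j),\ (i,j)\in D \mid a_kx(i,j)-a_jx(i,k)+a_ix(j,k)=0,\ (i,j,k)\in E\rangle .$$
   Context: For $1\leq i\neq j\leq n$, $v(i,j)\in S$ is the vector whose $i$th entry is $-a_j$, whose $j$th entry is $a_i$, and whose other entries are $0$. $D$ is the set of pairs $(i,j)$ with $1\leq i<j\leq n$ and $\{i,j\}\cap M\neq\emptyset$. $E$ is the set of triples $(i,j,k)$ with $1\leq i<j<k\leq n$ and $|\{i,j,k\}\cap M|\geq 2$. $X$ is a free $R$-module with basis $x(i,j)$, $(i,j)\in D$, and $\Lambda:X\to S$ is the $R$-module homomorphism with $\Lambda(x(i,j))=v(i,j)$ (it is surjective, since the $v(i,j)$ with $(i,j)\in D$ span $S$). $Y$ is the $R$-span in $X$ of the elements $y(i,j,k)=a_kx(i,j)-a_jx(i,k)+a_ix(j,k)$, $(i,j,k)\in E$ (so $Y=0$ if $E$ is empty). *)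

(* Defs.v *)
From HB Require Import structures.
From mathcomp Require Import all_boot all_algebra.
From mathcomp Require Import boolp.

Set Implicit Arguments.
Unset Strict Implicit.
Unset Printing Implicit Defensive.

Import GRing.Theory.

Local Open Scope quotient_scope.
Local Open Scope ring_scope.

Definition is_ideal (R : comNzRingType) (I : R -> Prop) : Prop :=
  [/\ I 0,
      forall x y, I x -> I y -> I (x + y)
    & forall r x, I x -> I (r * x)].

Definition is_pid (R : idomainType) : Prop :=
  forall I : R -> Prop, is_ideal I ->
    exists d : R, forall x, I x <-> exists r, x = r * d.

Section Span.
Variables (R : nzRingType) (V : lmodType R) (I : finType).

(* Membership in the span over a ring is not decidable in general; [`[< _ >]]
   makes the predicate boolean classically, as the quotient construction of
   ring_quotient requires. *)
Definition lspan (A : {set I}) (f : I -> V) : {pred V} :=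
  fun x => `[< exists c : I -> R, x = \sum_(i in A) c i *: f i >].

Lemma lspanP (A : {set I}) (f : I -> V) (x : V) :
  reflect (exists c : I -> R, x = \sum_(i in A) c i *: f i) (x \in lspan A f).
Proof. exact: asboolP. Qed.

Lemma lspan_submod (A : {set I}) (f : I -> V) : submod_closed (lspan A f).
Proof.
split.
  apply/lspanP; exists (fun=> 0); rewrite big1 // => i _.
  by rewrite scale0r.
move=> r x y /lspanP[c ->] /lspanP[d ->].
apply/lspanP; exists (fun i => r * c i + d i).
rewrite scaler_sumr -big_split /=; apply: eq_bigr => i _.
by rewrite scalerDl scalerA.
Qed.

HB.instance Definition _ (A : {set I}) (f : I -> V) :=
  GRing.isSubmodClosed.Build R V (lspan A f) (lspan_submod A f).

(* The quotient of [V] by the submodule spanned by the [f i], [i \in A]: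
   when [V] is free, the module presented by the relations [f i = 0]. *)
Definition presented (A : {set I}) (f : I -> V) : Type :=
  Quotient.quot (lspan A f).

Variables (A : {set I}) (f : I -> V).
Local Notation Q := (presented A f).

HB.instance Definition _ := Choice.on Q.
HB.instance Definition _ := GRing.Zmodule.on Q.
HB.instance Definition _ := EqQuotient.on Q.

Definition presented_scale (r : R) (x : Q) : Q := \pi_Q (r *: repr x).

Lemma presented_eqP (x y : V) : reflect (\pi_Q x = \pi_Q y) (x - y \in lspan A f).
Proof. by rewrite (Quotient.idealrBE (lspan A f)); exact: eqP. Qed.

Lemma pi_presented_zmod_morphism : zmod_morphism (\pi_Q : V -> Q).
Proof. exact: (pi_is_zmod_morphism (Quotient.quot (lspan A f))). Qed.

Lemma presented_scaleE (r : R) (x : V) :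
  presented_scale r (\pi_Q x) = \pi_Q (r *: x).
Proof.
apply/presented_eqP; rewrite -scalerBr rpredZ //.
by apply/presented_eqP; rewrite reprK.
Qed.

Let piD (x y : V) : \pi_Q (x + y) = \pi_Q x + \pi_Q y :> Q.
Proof.
have pi0 : \pi_Q 0 = 0 :> Q.
  by rewrite -(subrr 0) pi_presented_zmod_morphism subrr.
have piN z : \pi_Q (- z) = - \pi_Q z :> Q.
  by rewrite -[- z]add0r pi_presented_zmod_morphism pi0 add0r.
by rewrite -{1}[y]opprK pi_presented_zmod_morphism piN opprK.
Qed.

Lemma presented_scaleA r s (x : Q) :
  presented_scale r (presented_scale s x) = presented_scale (r * s) x.
Proof.
rewrite -[x]reprK [presented_scale s _]presented_scaleE.
by rewrite !presented_scaleE scalerA.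
Qed.

Lemma presented_scale1 : left_id 1 presented_scale.
Proof. by move=> x; rewrite -[x]reprK presented_scaleE scale1r. Qed.

Lemma presented_scaleDr : right_distributive presented_scale +%R.
Proof.
move=> r x y; rewrite -[x]reprK -[y]reprK.
by rewrite -piD !presented_scaleE scalerDr piD.
Qed.

Lemma presented_scaleDl (x : Q) : {morph presented_scale^~ x : r s / r + s}.
Proof.
by move=> r s; rewrite -[x]reprK !presented_scaleE scalerDl piD.
Qed.

HB.instance Definition _ := GRing.Zmodule_isLmodule.Build R Q
  presented_scaleA presented_scale1 presented_scaleDr presented_scaleDl.

Lemma pi_presented_linear : linear (\pi_Q : V -> Q).
Proof. by move=> r x y; rewrite piD -presented_scaleE. Qed.

End Span.

Section Presentation.
Variables (R : idomainType) (n : nat) (a : 'I_n -> R) (M : {set 'I_n}).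

Definition inS : {pred 'rV[R]_n} := fun x => \sum_i a i * x 0 i == 0.

Lemma inS_submod : submod_closed inS.
Proof.
split; rewrite ?unfold_in.
  by rewrite big1 // => i _; rewrite mxE mulr0.
move=> r x y; rewrite !unfold_in => /eqP Sx /eqP Sy.
rewrite (eq_bigr (fun i => r * (a i * x 0 i) + a i * y 0 i)); last first.
  by move=> i _; rewrite !mxE mulrDr mulrCA.
by rewrite big_split /= -mulr_sumr Sx Sy mulr0 addr0.
Qed.

HB.instance Definition _ := GRing.isSubmodClosed.Build R 'rV[R]_n inS inS_submod.

Definition Smod : Type := {x : 'rV[R]_n | x \in inS}.

HB.instance Definition _ := SubChoice.on Smod.
HB.instance Definition _ := [SubChoice_isSubLmodule of Smod by <:].

(* Meaningful for [i != j] only. *)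
Definition vvec (i j : 'I_n) : 'rV[R]_n :=
  \row_k (if k == i then - a j else if k == j then a i else 0).

Lemma vvec_inS (i j : 'I_n) : i != j -> vvec i j \in inS.
Proof.
move=> ij; rewrite unfold_in (bigD1 i) //= (bigD1 j) 1?eq_sym //=.
rewrite big1 ?addr0; last first.
  by move=> k /andP[/negPf ki /negPf kj]; rewrite mxE ki kj mulr0.
by rewrite !mxE !eqxx [j == i]eq_sym (negPf ij) mulrN mulrC addNr.
Qed.

Definition Dset : {set 'I_n * 'I_n} :=
  [set p : 'I_n * 'I_n | (p.1 < p.2)%N && ([set p.1; p.2] :&: M != set0)].

Definition Eset : {set 'I_n * 'I_n * 'I_n} :=
  [set t : 'I_n * 'I_n * 'I_n | [&& (t.1.1 < t.1.2)%N, (t.1.2 < t.2)%N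
             & (2 <= #|[set t.1.1; t.1.2; t.2] :&: M|)%N]].

Definition Dtype : Type := {p : 'I_n * 'I_n | p \in Dset}.
HB.instance Definition _ := SubFinite.on Dtype.

Lemma D_neq (d : Dtype) : (val d).1 != (val d).2.
Proof.
by case: d => -[i j] /=; rewrite inE => /andP[ij _]; rewrite neq_ltn ij.
Qed.

Definition vgen (d : Dtype) : Smod :=
  Sub (vvec (val d).1 (val d).2) (vvec_inS (D_neq d)).

(* The free module on [Dset]; its basis is [xgen i j], [(i, j) \in Dset]. *)
Definition Xmod : Type := {ffun Dtype -> R^o}.
HB.instance Definition _ := GRing.Lmodule.on Xmod.

(* The basis vector indexed by (i, j) if [(i, j) \in Dset], and 0 otherwise; by
   [Eset_Dset] only the former occurs in [yrel t] with [t \in Eset]. *)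
Definition xgen (i j : 'I_n) : Xmod := [ffun d : Dtype => (val d == (i, j))%:R : R^o].

Definition yrel (t : 'I_n * 'I_n * 'I_n) : Xmod :=
  let: (i, j, k) := t in a k *: xgen i j - a j *: xgen i k + a i *: xgen j k.

Lemma Eset_Dset (i j k : 'I_n) : (i, j, k) \in Eset ->
  [/\ (i, j) \in Dset, (i, k) \in Dset & (j, k) \in Dset].
Proof.
rewrite !inE /= => /and3P[ij jk c2]; rewrite ij jk (ltn_trans ij jk) /=.
have key (p q r : 'I_n) : [set i; j; k] = r |: [set p; q] ->
    [set p; q] :&: M != set0.
  move=> e; rewrite e in c2; apply: contraL c2 => /eqP pq0.
  rewrite -ltnNge ltnS setIUl pq0 setU0.
  by rewrite (leq_trans (subset_leq_card (subsetIl _ _))) ?cards1.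
split; [apply: (key i j k)|apply: (key i k j)|apply: (key j k i)].
- by rewrite setUC.
- by rewrite setUA [j |: _]setUC.
- by rewrite setUA.
Qed.

Definition Lambda (u : Xmod) : Smod := \sum_(d : Dtype) u d *: vgen d.

Lemma Lambda_linear : linear Lambda.
Proof.
move=> r u w; rewrite /Lambda scaler_sumr -big_split /=.
by apply: eq_bigr => d _; rewrite !ffunE scalerDl scalerA.
Qed.

HB.instance Definition _ := GRing.isLinear.Build R Xmod Smod _ Lambda Lambda_linear.

Lemma Lambda_xgen (d : Dtype) : Lambda (xgen (val d).1 (val d).2) = vgen d.
Proof.
rewrite /Lambda (bigD1 d) //= big1 ?addr0; last first.
  move=> e ed; rewrite ffunE -surjective_pairing.
  by rewrite (inj_eq val_inj) (negPf ed) scale0r.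
by rewrite ffunE -surjective_pairing eqxx scale1r.
Qed.

Definition Ymod : {pred Xmod} := lspan Eset yrel.

End Presentation.

Arguments Ymod {R n} a M.

(* Main.v *)
(** Let [1 = \sum_(m in M) c m * a m].  The linear map [h : R^n -> X] sending
    [e_j] to [\sum_(m in M) c m *: x(m,j)], with [x] extended to an alternating
    family, is a contracting homotopy: modulo the relations [y(m,i,j)] one has
    [h (v(i,j)) = \sum_(m in M) c m *: (a m *: x(i,j)) = x(i,j)], hence
    [h (Lambda u) = u] modulo [Y]; and [Lambda (h s) = s] for [s] in [S]. *)
From HB Require Import structures.
Require Import Defs.
From mathcomp Require Import all_boot all_algebra.
From mathcomp Require Import boolp ring.
Set Implicit Arguments.
Unset Strict Implicit.
Unset Printing Implicit Defensive.
Import GRing.Theory.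
Local Open Scope quotient_scope.
Local Open Scope ring_scope.

Lemma lspan_gen (R : nzRingType) (V : lmodType R) (I : finType) (A : {set I})
  (f : I -> V) (i : I) : i \in A -> f i \in lspan A f.
Proof.
move=> Ai; apply/lspanP; exists (fun j => (j == i)%:R).
rewrite (bigD1 i) //= eqxx scale1r big1 ?addr0 // => j /andP[_ /negPf->].
exact: scale0r.
Qed.

(** * The isomorphism induced on a module given by relations *)

Section FirstIsomorphism.
Variables (R : nzRingType) (V W : lmodType R) (I : finType).
Variables (A : {set I}) (f : I -> V) (g : {linear V -> W}).
Hypothesis kerg : forall u, g u = 0 <-> u \in lspan A f.
Hypothesis surjg : forall w, exists u, g u = w.
Local Notation Q := (presented A f).

Definition presented_lift (q : Q) : W := g (repr q).

Lemma presented_liftE u : presented_lift (\pi_Q u) = g u.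
Proof.
(* The chosen representative of the class of [u] differs from [u] by an element of the span, which
   [g] kills. *)
apply/subr0_eq; rewrite -linearB; apply/kerg/presented_eqP; exact: reprK.
Qed.

Lemma presented_lift_linear : linear presented_lift.
Proof.
move=> r p q; rewrite -[p]reprK -[q]reprK -pi_presented_linear.
by rewrite !presented_liftE linearP.
Qed.

HB.instance Definition _ :=
  GRing.isLinear.Build R Q W _ presented_lift presented_lift_linear.

(** The inverse sends [w] to the class of a chosen preimage; two preimages differ by an element of
    the kernel, so their classes agree. *)
Lemma presented_iso : exists F : {linear Q -> W},
  bijective F /\ forall u, F (\pi_Q u) = g u.
Proof.
exists presented_lift; split; last exact: presented_liftE.
have [s sK] := choice surjg.
exists (fun w => \pi_Q (s w)) => [q|w]; last by rewrite /= presented_liftE.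
rewrite -[RHS]reprK; apply/presented_eqP/kerg.
by rewrite linearB sK subrr.
Qed.

End FirstIsomorphism.

Section Homotopy.
Variables (R : idomainType) (n : nat) (a : 'I_n -> R) (M : {set 'I_n}).
Implicit Types (i j k m : 'I_n).
Local Notation X := (Xmod R M).

(** * Alternating extension of the generators and relations *)

Lemma Dset_lt (d : 'I_n * 'I_n) : d \in Dset M ->
  (d.1 < d.2)%N /\ ((d.1 \in M) || (d.2 \in M)).
Proof.
rewrite inE => /andP[-> /set0Pn[x]]; rewrite !inE => /andP[].
by case/orP=> /eqP-> ->; rewrite ?orbT.
Qed.

(* At most one of the two terms is nonzero, by the convention on [xgen]. *)
Definition xalt i j : X := xgen R M i j - xgen R M j i.

Lemma xaltC i j : xalt j i = - xalt i j.
Proof. by rewrite opprB. Qed.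

Lemma xaltii i : xalt i i = 0.
Proof. exact: subrr. Qed.

Lemma xgen_notD i j : (i, j) \notin Dset M -> xgen R M i j = 0.
Proof.
move=> ijD; apply/ffunP => d; rewrite !ffunE; case: eqP => // dE.
by case/negP: ijD; rewrite -dE; exact: valP.
Qed.

Lemma xalt_lt i j : (i < j)%N -> xalt i j = xgen R M i j.
Proof.
(* The pair [(j, i)] is decreasing, hence outside [Dset], and its [xgen] is 0 by convention. *)
move=> ij; rewrite /xalt [X in _ - X]xgen_notD ?subr0 //.
by rewrite inE /= ltnNge ltnW.
Qed.

(** Extends [yrel] to unordered triples; being alternating, it spares the homotopy a case split on
    the order of its indices. *)
Definition yalt i j k : X := a k *: xalt i j - a j *: xalt i k + a i *: xalt j k.

Lemma yalt_swap12 i j k : yalt j i k = - yalt i j k.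
Proof.
by rewrite /yalt [xalt j i]xaltC scalerN !opprD opprK -!addrA [X in _ + X]addrC.
Qed.

Lemma yalt_swap23 i j k : yalt i k j = - yalt i j k.
Proof.
rewrite /yalt [xalt k j]xaltC scalerN !opprD opprK.
by rewrite [- _ + a j *: _]addrC.
Qed.

Lemma yalt_iik i k : yalt i i k = 0.
Proof. by rewrite /yalt xaltii scaler0 add0r addNr. Qed.

Lemma yalt_sorted_in_Y i j k : (i < j)%N -> (j < k)%N ->
  (2 <= #|[set i; j; k] :&: M|)%N -> yalt i j k \in Ymod a M.
Proof.
move=> ij jk c; have -> : yalt i j k = yrel a M (i, j, k).
  by rewrite /yalt !xalt_lt // (ltn_trans ij jk).
by apply: lspan_gen; rewrite inE /= ij jk.
Qed.

(** Adjacent transpositions only change the sign and preserve the index set, so the triple may be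
    sorted. *)
Lemma yalt_in_Y i j k : i != j -> j != k -> i != k ->
  (2 <= #|[set i; j; k] :&: M|)%N -> yalt i j k \in Ymod a M.
Proof.
pose P p q r := (2 <= #|[set p; q; r] :&: M|)%N -> yalt p q r \in Ymod a M.
have P12 p q r : P q p r -> P p q r.
  by rewrite /P [[set q; p]]setUC yalt_swap12 rpredN.
have P23 p q r : P p r q -> P p q r by rewrite /P setUAC yalt_swap23 rpredN.
have P_lt (p q r : 'I_n) : (p < q)%N -> (q < r)%N -> P p q r by exact: yalt_sorted_in_Y.
rewrite -!val_eqE /=.
(* Of the eight sign patterns, six are the orders of three distinct indices and two are cyclic,
   hence absurd. *)
case: (ltngtP i j) => // ij _; case: (ltngtP j k) => // jk _;
  case: (ltngtP i k) => // ik _; rewrite -/(P i j k).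
- exact: P_lt.
- by have := ltn_trans (ltn_trans ij jk) ik; rewrite ltnn.
- by apply: P23; exact: P_lt.
- by apply/P23/P12; exact: P_lt.
- by apply: P12; exact: P_lt.
- by apply/P12/P23; exact: P_lt.
- by have := ltn_trans (ltn_trans jk ij) ik; rewrite ltnn.
- by apply/P12/P23/P12; exact: P_lt.
Qed.

(** If [m] is [i] or [j], alternation gives 0. Otherwise [m] and whichever of [i], [j] lies in [M]
    are two elements of [M] in the triple. *)
Lemma yalt_mij_in_Y m i j : m \in M -> i != j -> (i \in M) || (j \in M) ->
  yalt m i j \in Ymod a M.
Proof.
move=> Mm ij Mij.
have [->|mi] := eqVneq m i; first by rewrite yalt_iik rpred0.
have [->|mj] := eqVneq m j.
  by rewrite -[yalt _ _ _]opprK -yalt_swap23 yalt_iik oppr0 rpred0.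
apply: yalt_in_Y => //.
have two p : p \in M -> p != m -> p \in [set m; i; j] ->
    (2 <= #|[set m; i; j] :&: M|)%N.
  move=> Mp pm pT; apply: (@leq_trans #|[set p; m]|); first by rewrite cards2 pm.
  apply/subset_leq_card/subsetP => x /set2P[] ->; rewrite in_setI ?Mp ?pT //.
  by rewrite Mm !inE eqxx.
case/orP: Mij => [Mi|Mj]; [apply: (two i)|apply: (two j)] => //.
- by rewrite eq_sym.
- by rewrite !inE eqxx orbT.
- by rewrite eq_sym.
- by rewrite !inE eqxx orbT.
Qed.

(** * Images of the generators and relations in [R^n] *)

(* Agrees with [vvec] off the diagonal, and vanishes on it. *)
Definition vrow i j : 'rV[R]_n := a i *: delta_mx 0 j - a j *: delta_mx 0 i.

Lemma vvecE i j : i != j -> vvec a i j = vrow i j.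
Proof.
move=> ij; apply/rowP => k; rewrite !mxE /=.
case: (eqVneq k i) => [->|ki].
  by rewrite (negPf ij) mulr0 mulr1 add0r.
by case: (k == j); rewrite ?mulr1 ?mulr0 subr0.
Qed.

Definition Lambda_row (u : X) : 'rV[R]_n := val (Lambda a u).

Lemma Lambda_row_linear : linear Lambda_row.
Proof. by move=> r u w; rewrite /Lambda_row Lambda_linear. Qed.

HB.instance Definition _ :=
  GRing.isLinear.Build R X 'rV[R]_n _ Lambda_row Lambda_row_linear.

Lemma Lambda_row_xalt i j : (i \in M) || (j \in M) ->
  Lambda_row (xalt i j) = vrow i j.
Proof.
have lt (p q : 'I_n) : (p < q)%N -> (p \in M) || (q \in M) ->
    Lambda_row (xalt p q) = vrow p q.
  move=> pq Mpq; have pqD : (p, q) \in Dset M.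
    rewrite inE /= pq; apply/set0Pn; case/orP: Mpq => [Mp|Mq]; [exists p|exists q].
      by rewrite !inE eqxx.
    by rewrite !inE eqxx orbT.
  rewrite /Lambda_row xalt_lt // (Lambda_xgen a (Sub (p, q) pqD : Dtype M)) /= vvecE //.
  by rewrite neq_ltn pq.
case: (ltngtP i j) => [ij|ji|/val_inj->]; first exact: lt.
  by rewrite xaltC linearN /= orbC => /(lt _ _ ji)->; rewrite opprB.
by rewrite xaltii linear0 /vrow subrr.
Qed.

Lemma Lambda_yrel t : t \in Eset M -> Lambda a (yrel a M t) = 0.
Proof.
case: t => [[i j] k] tE; have [ijD ikD jkD] := Eset_Dset tE.
have [[ij Mij] [ik Mik] [jk Mjk]] := And3 (Dset_lt ijD) (Dset_lt ikD) (Dset_lt jkD).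
apply/val_inj; rewrite -[LHS]/(Lambda_row _) raddf0 /yrel -!xalt_lt //.
rewrite linearD linearB !linearZ /= !Lambda_row_xalt //.
by apply/rowP => l; rewrite !mxE; ring.
Qed.

(** * The contracting homotopy *)

Variable c : 'I_n -> R.
Hypothesis ca1 : \sum_(m in M) c m * a m = 1.

(** The map [h], taken on all of [R^n] rather than on [S] so that it can be evaluated at unit
    vectors. *)
Definition koszul (s : 'rV[R]_n) : X :=
  \sum_j s 0 j *: \sum_(m in M) c m *: xalt m j.

Lemma koszul_linear : linear koszul.
Proof.
move=> r s t; rewrite /koszul scaler_sumr -big_split /=.
by apply: eq_bigr => j _; rewrite !mxE scalerDl scalerA.
Qed.

HB.instance Definition _ :=
  GRing.isLinear.Build R 'rV[R]_n X _ koszul koszul_linear.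

Lemma koszul_delta j : koszul (delta_mx 0 j) = \sum_(m in M) c m *: xalt m j.
Proof.
rewrite /koszul (bigD1 j) //= [X in _ + X]big1 ?addr0 => [|k /negPf kj].
  by rewrite mxE !eqxx scale1r.
by rewrite mxE kj andbF scale0r.
Qed.

Lemma Lambda_koszul (s : Smod a) : Lambda a (koszul (val s)) = s.
Proof.
apply/val_inj; rewrite -[LHS]/(Lambda_row _) /koszul linear_sum /=.
have /eqP sS : \sum_j a j * val s 0 j == 0 by exact: valP s.
(* The [j]-th summand maps to [s_j e_j - a_j s_j e]; the multiples of [e] add up to 0 because [s]
   lies in [S]. *)
pose e : 'rV[R]_n := \sum_(m in M) c m *: delta_mx 0 m.
rewrite (eq_bigr (fun j => val s 0 j *: delta_mx 0 j - (a j * val s 0 j) *: e)).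
  by rewrite sumrB -scaler_suml sS scale0r subr0 [RHS]row_sum_delta.
move=> j _; rewrite linearZ linear_sum /= mulrC -scalerA -scalerBr; congr (_ *: _).
rewrite (eq_bigr (fun m => (c m * a m) *: delta_mx 0 j - a j *: (c m *: delta_mx 0 m))).
  by rewrite sumrB -scaler_suml ca1 scale1r -scaler_sumr.
move=> m Mm; rewrite linearZ /= Lambda_row_xalt ?Mm //.
by rewrite /vrow scalerBr !scalerA [c m * a j]mulrC.
Qed.

(** Write [x i j] as the sum of the [(c m * a m) *: x i j]; the signs on the right are grouped as in
    [yalt m i j]. *)
Lemma alternating_sum (V : lmodType R) (x : 'I_n -> 'I_n -> V) i j :
  a i *: (\sum_(m in M) c m *: x m j) - a j *: (\sum_(m in M) c m *: x m i)
    - x i j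
  = - \sum_(m in M) c m *: (a j *: x m i - a i *: x m j + a m *: x i j).
Proof.
rewrite [in RHS](eq_bigr (fun m => a j *: (c m *: x m i) - a i *: (c m *: x m j)
    + (c m * a m) *: x i j)); last first.
  by move=> m _; rewrite scalerDr scalerBr !scalerA ![c m * a _]mulrC.
rewrite big_split sumrB -scaler_suml ca1 scale1r -!scaler_sumr /=.
by rewrite !opprD opprK [in RHS](addrC (- _)).
Qed.

Lemma koszul_vrow i j : i != j -> (i \in M) || (j \in M) ->
  koszul (vrow i j) - xalt i j \in Ymod a M.
Proof.
move=> ij Mij.
have -> : koszul (vrow i j) - xalt i j = - \sum_(m in M) c m *: yalt m i j.
  rewrite linearB [X in X - _ - _]linearZ [X in _ - X - _]linearZ /=.
  rewrite !koszul_delta; exact: alternating_sum.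
by rewrite rpredN rpred_sum // => m Mm; rewrite rpredZ // yalt_mij_in_Y.
Qed.

Lemma DtypeP (d : Dtype M) :
  ((val d).1 < (val d).2)%N /\ (((val d).1 \in M) || ((val d).2 \in M)).
Proof. exact/Dset_lt/valP. Qed.

Lemma xalt_coord (u : X) : u = \sum_d u d *: xalt (val d).1 (val d).2.
Proof.
apply/ffunP => d; rewrite sum_ffunE.
rewrite (eq_bigr (fun e => u e * (val d == val e)%:R)) => [|e _]; last first.
  by rewrite xalt_lt ?(DtypeP e).1 // !ffunE -surjective_pairing.
rewrite (bigD1 d) // big1 => [|e /andP[_ ed]].
  by rewrite /= eqxx mulr1 addr0.
by rewrite (inj_eq val_inj) eq_sym (negPf ed) mulr0.
Qed.

(** By linearity it suffices to treat basis vectors, which is [koszul_vrow]. *)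
Lemma koszul_Lambda (u : X) : koszul (Lambda_row u) - u \in Ymod a M.
Proof.
have -> : koszul (Lambda_row u) - u = \sum_d u d *:
    (koszul (Lambda_row (xalt (val d).1 (val d).2)) - xalt (val d).1 (val d).2).
  rewrite [in RHS](eq_bigr (fun d =>
    koszul (Lambda_row (u d *: xalt (val d).1 (val d).2))
      - u d *: xalt (val d).1 (val d).2)).
    by rewrite sumrB -!linear_sum -xalt_coord.
  by move=> d _; rewrite scalerBr !linearZ.
apply: rpred_sum => d _; have [d12 Md] := DtypeP d.
by rewrite rpredZ // Lambda_row_xalt // koszul_vrow // neq_ltn d12.
Qed.

Lemma Lambda_eq0 (u : X) : Lambda a u = 0 <-> u \in Ymod a M.
Proof.
split=> [u0|/lspanP[r ->]].
  (* When [Lambda a u] is 0, the homotopy relation reads [- u \in Ymod a M]. *)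
  by have := koszul_Lambda u; rewrite /Lambda_row u0 /= linear0 sub0r rpredN.
by rewrite linear_sum big1 // => t tE; rewrite linearZ /= Lambda_yrel ?scaler0.
Qed.

End Homotopy.

Theorem theorem2p4 (R : idomainType) (hR : is_pid R) (n : nat) (hn : (2 <= n)%N)
    (a : 'I_n -> R)
    (ha : forall r : R, (r : R^o) \in lspan [set: 'I_n] (a : 'I_n -> R^o))
    (M : {set 'I_n})
    (hM : forall r : R, (r : R^o) \in lspan M (a : 'I_n -> R^o)) :
  (forall u : Xmod R M, Lambda a u = 0 <-> u \in Ymod a M) /\
  (exists f : {linear presented (Eset M) (yrel a M) -> Smod a},
     bijective f /\
     forall d : Dtype M,
       f (\pi_(presented (Eset M) (yrel a M)) (xgen R M (val d).1 (val d).2)) = vgen a d).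
Proof.
have /lspanP[c one_c] := hM 1.
have ca1 : \sum_(m in M) c m * a m = 1 := esym one_c.
have kerL := Lambda_eq0 ca1; split=> //.
(* On [S], [koszul] is a section of [Lambda]. *)
have surjL s : exists u : Xmod R M, Lambda a u = s.
  by exists (koszul M c (val s)); exact: Lambda_koszul.
have [f [bij_f fE]] := presented_iso kerL surjL.
by exists f; split=> // d; rewrite fE; exact: Lambda_xgen.
Qed.
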